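(* If a 3-hypergraph $\mathbb{H}=(V,E)$ is 2-robustly strong 3-colorable, then $\mathbf{V}(S_{\mathbb{H}})=\mathbf{V}(S_c(abc))$.
   Context: A hypergraph $\mathbb{H}=(V,E)$ consists of a finite set $V$ of vertices and a set $E$ of subsets of $V$ (hyperedges). Here a 3-hypergraph means a finite 3-uniform hypergraph (every hyperedge has exactly 3 elements) with at least one hyperedge, which is linear (any two distinct hyperedges share at most one vertex) and in which every vertex lies in some hyperedge. A subhyperedge is a nonempty subset of a hyperedge. Two subhyperedges $e_1',e_2'$ are linked if there is a single vertex $w\notin e_1'\cup e_2'$ such that $e_1'\cup\{w\}$ and $e_2'\cup\{w\}$ are both hyperedges. The 3-hypergraph semigroup of $\mathbb{H}$ is the semigroup given by the presentation with generators $\mathbf{a}_u$ ($u\in V$) and $0$, and relations: $\mathbf{a}_u\mathbf{a}_v=\mathbf{a}_v\mathbf{a}_u$; $0\mathbf{a}_u=\mathbf{a}_u0=00=0$; $\mathbf{a}_u\mathbf{a}_v=0$ if $u=v$ or $\{u,v\}$ is not a subhyperedge; $\mathbf{a}_u\mathbf{a}_v\mathbf{a}_h=0$ if $\{u,v,h\}\notin E$; $\mathbf{a}_{u_i}\mathbf{a}_{u_j}=\mathbf{a}_{u_r}\mathbf{a}_{u_l}$ if $\{u_i,u_j\}$ and $\{u_r,u_l\}$ are linked; and for every hyperedge $\{u,v,w\}$, $\mathbf{a}_u\mathbf{a}_v\mathbf{a}_w=\mathbf{a}$, where $\mathbf{a}$ is one and the same (nonzero) element for all hyperedges. This semigroup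 with zero is 0-cancellative, and therefore becomes a semiring $S_{\mathbb{H}}$, called the 3-hypergraph semiring of $\mathbb{H}$, under the flat addition $x+x=x$ and $x+y=0$ for $x\ne y$. A strong 3-coloring of $\mathbb{H}$ is a map $\varphi:V\to\{0,1,2\}$ such that the vertices of each hyperedge receive pairwise different colors. $\mathbb{H}$ is 2-robustly strong 3-colorable if for every 2-element subset $\{u,v\}$ of $V$, every map $\varphi':\{u,v\}\to\{0,1,2\}$ that is valid (meaning $\varphi'(u)\ne\varphi'(v)$ whenever $\{u,v\}$ is a subhyperedge) extends to a strong 3-coloring of $\mathbb{H}$. For a word $w$ in the free commutative semigroup, $S_c(w)$ is the set of all nonempty subwords (divisors) of $w$ together with a new element $0$; the product $u\cdot v$ is $uv$ if $uv$ is a nonempty subword of $w$, and $0$ otherwise; addition is flat: $x+x=x$ and $x+y=0$ for $x\neq y$. Here $a,b,c$ are distinct letters. $\mathbf{V}(S)$ denotes the variety generated by the semiring $S$, in the signature $\{+,\cdot\}$ (both operations associative, $+$ commutative, $\cdot$ distributing over $+$ on both sides). *)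

(* Defs.v *)
From HB Require Import structures.
From mathcomp Require Import all_boot.
From mathcomp Require Import finmap multiset boolp.

Set Implicit Arguments.
Unset Strict Implicit.
Unset Printing Implicit Defensive.

(** The signature is {+, *}: no neutral elements.  Carriers are nonempty, as is
    usual in universal algebra. *)

Record semiring := Semiring {
  sr_sort :> Type;
  sr_add : sr_sort -> sr_sort -> sr_sort;
  sr_mul : sr_sort -> sr_sort -> sr_sort;
  sr_nonempty : exists x : sr_sort, True;
  sr_addA : associative sr_add;
  sr_addC : commutative sr_add;
  sr_mulA : associative sr_mul;
  sr_mulDl : left_distributive sr_mul sr_add;
  sr_mulDr : right_distributive sr_mul sr_add }.

Definition semiring_hom (A B : semiring) (f : A -> B) : Prop :=
  {morph f : x y / sr_add x y} /\ {morph f : x y / sr_mul x y}.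

Section ProductSemiring.
Variables (I : Type) (A : I -> semiring).

Let add (x y : forall i, A i) : forall i, A i := fun i => sr_add (x i) (y i).
Let mul (x y : forall i, A i) : forall i, A i := fun i => sr_mul (x i) (y i).

Fact product_nonempty : exists x : forall i, A i, True.
Proof. by exists (fun i => sval (cid (sr_nonempty (A i)))). Qed.

Fact product_addA : associative add.
Proof. by move=> x y z; apply: functional_extensionality_dep => i; apply: sr_addA. Qed.

Fact product_addC : commutative add.
Proof. by move=> x y; apply: functional_extensionality_dep => i; apply: sr_addC. Qed.

Fact product_mulA : associative mul.
Proof. by move=> x y z; apply: functional_extensionality_dep => i; apply: sr_mulA. Qed.

Fact product_mulDl : left_distributive mul add.
Proof. by move=> x y z; apply: functional_extensionality_dep => i; apply: sr_mulDl. Qed.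

Fact product_mulDr : right_distributive mul add.
Proof. by move=> x y z; apply: functional_extensionality_dep => i; apply: sr_mulDr. Qed.

Definition product_semiring : semiring :=
  Semiring product_nonempty product_addA product_addC product_mulA
           product_mulDl product_mulDr.

End ProductSemiring.

(** Closure under homomorphic images, subalgebras and products; the first two
    clauses also give closure under isomorphism. *)
Definition is_variety (K : semiring -> Prop) : Prop :=
  [/\ forall (A B : semiring) (f : A -> B),
        semiring_hom f -> (forall y, exists x, f x = y) -> K A -> K B,
      forall (A B : semiring) (f : A -> B),
        semiring_hom f -> injective f -> K B -> K A &
      forall (I : Type) (A : I -> semiring),
        (forall i, K (A i)) -> K (product_semiring A)].

(** [variety_gen S] is V(S), the least variety containing [S]. *)
Definition variety_gen (S : semiring) : semiring -> Prop :=
  fun A => forall K : semiring -> Prop, is_variety K -> K S -> K A.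

Section Flat.
Local Open Scope group_scope.
Variable S : semigroupType.

Definition is_zero (z : S) : Prop :=
  left_zero z (@mul S) /\ right_zero z (@mul S).

Definition zero_cancellative (z : S) : Prop :=
  (forall x y t : S, x * y = x * t -> x * y <> z -> y = t) /\
  (forall x y t : S, y * x = t * x -> y * x <> z -> y = t).

Variables (z : S) (z0 : is_zero z) (zc : zero_cancellative z).

Definition flat_add (x y : S) : S := if x == y then x else z.

Fact flat_nonempty : exists x : S, True. Proof. by exists z. Qed.

Fact flat_addC : commutative flat_add.
Proof. by move=> x y; rewrite /flat_add eq_sym; case: eqP => [->|]. Qed.

Fact flat_addA : associative flat_add.
Proof.
have add0 y : flat_add z y = z by rewrite /flat_add; case: ifP.
have addr0 y : flat_add y z = z by rewrite flat_addC.
move=> x y t; rewrite {2}/flat_add.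
case: (eqVneq y t) => [<-|nyt].
  rewrite {3}/flat_add; case: (eqVneq x y) => [->|nxy].
    by rewrite /flat_add !eqxx.
  by rewrite add0 /flat_add (negPf nxy).
rewrite addr0 {2}/flat_add; case: (eqVneq x y) => [->|_]; last by rewrite add0.
by rewrite /flat_add (negPf nyt).
Qed.

Fact flat_mulDl : left_distributive (@mul S) flat_add.
Proof.
move=> x y t; rewrite /flat_add.
case: (eqVneq x y) => [->|nxy]; first by rewrite eqxx.
rewrite z0.1; case: eqP => [e|//]; case: (eqVneq (x * t) z) => [->//|nz].
by case/eqP: nxy; apply: zc.2 e _; apply/eqP.
Qed.

Fact flat_mulDr : right_distributive (@mul S) flat_add.
Proof.
move=> x y t; rewrite /flat_add.
case: (eqVneq y t) => [->|nyt]; first by rewrite eqxx.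
rewrite z0.2; case: eqP => [e|//]; case: (eqVneq (x * y) z) => [->//|nz].
by case/eqP: nyt; apply: zc.1 e _; apply/eqP.
Qed.

Definition flat_semiring : semiring :=
  Semiring flat_nonempty flat_addA flat_addC (@mulgA S) flat_mulDl flat_mulDr.

End Flat.

(** The pair [(x, s)] stands for the nonempty word [x :: s]. *)
Definition free_semigroup (X : choiceType) : Type := (X * seq X)%type.
HB.instance Definition _ (X : choiceType) :=
  Choice.copy (free_semigroup X) (X * seq X)%type.

Definition free_mul (X : choiceType) (s t : free_semigroup X) :
  free_semigroup X := (s.1, s.2 ++ t.1 :: t.2).

Fact free_mulA (X : choiceType) : associative (@free_mul X).
Proof. by move=> s t r; rewrite /free_mul /= -catA. Qed.

HB.instance Definition _ (X : choiceType) :=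
  isSemigroup.Build (free_semigroup X) (@free_mulA X).

Definition letter (X : choiceType) (x : X) : free_semigroup X := (x, [::]).

Section Quotient.
Local Open Scope group_scope.
Local Open Scope quotient_scope.
Variables (G : semigroupType) (R : G -> G -> Prop).

Inductive cong : G -> G -> Prop :=
| cong_rel x y : R x y -> cong x y
| cong_refl x : cong x x
| cong_sym x y : cong x y -> cong y x
| cong_trans x y t : cong x y -> cong y t -> cong x t
| cong_mul x x' y y' : cong x x' -> cong y y' -> cong (x * y) (x' * y').

Definition congb : rel G := fun x y => `[< cong x y >].

Fact congb_refl : reflexive congb.
Proof. by move=> x; apply/asboolP; apply: cong_refl. Qed.

Fact congb_sym : symmetric congb.
Proof. by move=> x y; apply/asboolP/asboolP; apply: cong_sym. Qed.

Fact congb_trans : transitive congb.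
Proof.
by move=> y x t /asboolP xy /asboolP yt; apply/asboolP; apply: cong_trans xy yt.
Qed.

Canonical congb_equiv := EquivRel congb congb_refl congb_sym congb_trans.

Definition quot_semigroup : Type := {eq_quot congb_equiv}.
HB.instance Definition _ := Choice.copy quot_semigroup {eq_quot congb_equiv}.
HB.instance Definition _ := EqQuotient.copy quot_semigroup {eq_quot congb_equiv}.

Definition quot_mul (x y : quot_semigroup) : quot_semigroup :=
  \pi_quot_semigroup (repr x * repr y).

Lemma quot_eqP (x y : G) :
  \pi_quot_semigroup x = \pi_quot_semigroup y <-> cong x y.
Proof. by split=> [/eqmodP/asboolP //|h]; apply/eqmodP/asboolP. Qed.

Lemma quot_mul_pi (x y : G) :
  quot_mul (\pi_quot_semigroup x) (\pi_quot_semigroup y) =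
  \pi_quot_semigroup (x * y).
Proof. by apply/quot_eqP; apply: cong_mul; apply/quot_eqP; rewrite reprK. Qed.

Fact quot_mulA : associative quot_mul.
Proof.
have reprP u : cong (repr (\pi_quot_semigroup u)) u.
  by apply/quot_eqP; rewrite reprK.
move=> x y t; apply/quot_eqP.
apply: (@cong_trans _ (repr x * repr y * repr t)).
  by rewrite -mulgA; apply: cong_mul (reprP _); apply: cong_refl.
by apply/cong_sym/cong_mul; [apply: reprP|apply: cong_refl].
Qed.

HB.instance Definition _ := isSemigroup.Build quot_semigroup quot_mulA.

Lemma quotM (x y : G) :
  \pi_quot_semigroup (x * y) =
  \pi_quot_semigroup x * \pi_quot_semigroup y :> quot_semigroup.
Proof. by rewrite -quot_mul_pi. Qed.

End Quotient.

Definition presented_semigroup (X : choiceType)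
    (R : free_semigroup X -> free_semigroup X -> Prop) : semigroupType :=
  quot_semigroup R.

Record hypergraph3 := Hypergraph3 {
  vertex : finType;
  hedge : {set {set vertex}};
  hedge_uniform : forall e, e \in hedge -> #|e| = 3;
  hedge_nonempty : hedge != set0;
  hedge_linear : forall e f, e \in hedge -> f \in hedge -> e != f ->
    #|e :&: f| <= 1;
  hedge_cover : forall v : vertex, exists2 e, e \in hedge & v \in e }.

Definition subhyperedge (H : hypergraph3) (s : {set vertex H}) : bool :=
  (s != set0) && [exists e in hedge H, s \subset e].

Definition linked (H : hypergraph3) (s t : {set vertex H}) : bool :=
  [&& subhyperedge s, subhyperedge t &
      [exists w, [&& w \notin s :|: t, w |: s \in hedge H &
                     w |: t \in hedge H]]].

Definition strong_3coloring (H : hypergraph3) (phi : vertex H -> 'I_3) : Prop :=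
  forall e, e \in hedge H -> {in e &, injective phi}.

(** A map defined on [U] only is given by an arbitrary total map [phi'], of
    which only the values on [U] matter. *)
Definition valid_on (H : hypergraph3) (U : {set vertex H})
    (phi' : vertex H -> 'I_3) : Prop :=
  {in U &, forall u v, u != v -> subhyperedge [set u; v] -> phi' u != phi' v}.

Definition robustly_strong_3colorable (k : nat) (H : hypergraph3) : Prop :=
  forall (U : {set vertex H}) (phi' : vertex H -> 'I_3),
    #|U| = k -> valid_on U phi' ->
    exists2 phi, strong_3coloring phi & {in U, phi =1 phi'}.

Section HypergraphSemiring.
Local Open Scope group_scope.
Local Open Scope quotient_scope.
Variable H : hypergraph3.
Notation V := (vertex H).
Notation E := (hedge H).

(** [Some u] is the generator a_u and [None] is the generator 0. *)
Notation hword := (free_semigroup (option V)).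
Definition gen (u : V) : hword := letter (Some u).
Definition gen0 : hword := letter None.

Inductive hyp_rel : hword -> hword -> Prop :=
| hyp_comm u v : hyp_rel (gen u * gen v) (gen v * gen u)
| hyp_0l u : hyp_rel (gen0 * gen u) gen0
| hyp_0r u : hyp_rel (gen u * gen0) gen0
| hyp_00 : hyp_rel (gen0 * gen0) gen0
| hyp_pair0 u v : u = v \/ ~~ subhyperedge [set u; v] ->
    hyp_rel (gen u * gen v) gen0
| hyp_triple0 u v h : [set u; v; h] \notin E ->
    hyp_rel (gen u * gen v * gen h) gen0
| hyp_linked i j r l : linked [set i; j] [set r; l] ->
    hyp_rel (gen i * gen j) (gen r * gen l)
  (* the element a is the common value of all the products over hyperedges *)
| hyp_edge u v w u' v' w' : [set u; v; w] \in E -> [set u'; v'; w'] \in E ->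
    hyp_rel (gen u * gen v * gen w) (gen u' * gen v' * gen w').

Let F (s : seq (option V)) : bool :=
  [&& size s == 3, None \notin s & [set x | Some x \in s] \in E].
Let tos (s : hword) : seq (option V) := s.1 :: s.2.

Let tosM (s t : hword) : tos (s * t) = tos s ++ tos t.
Proof. by []. Qed.

Let F_perm s t : perm_eq s t -> F s = F t.
Proof.
move=> st; rewrite /F (perm_size st) (perm_mem st); suff -> : [set x | Some x \in s] = [set x | Some x \in t] by [].
by apply/setP => x; rewrite !inE (perm_mem st).
Qed.

Let F_swap s t r : F (s ++ t ++ r) = F (t ++ s ++ r).
Proof. exact/F_perm/permPl/perm_catCA. Qed.

Let set3E (u v w : V) :
  [set x | Some x \in [:: Some u; Some v; Some w]] = [set u; v; w].
Proof. by apply/setP => x; rewrite !inE /= !(inj_eq Some_inj) -orbA. Qed.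

Let F3 u v w : F [:: Some u; Some v; Some w] = ([set u; v; w] \in E).
Proof. by rewrite /F set3E. Qed.

Let F_inv s : F s ->
  exists u v w, s = [:: Some u; Some v; Some w] /\ [set u; v; w] \in E.
Proof.
case: s => [|[u|] [|[v|] [|[w|] [|? ?]]]]; rewrite ?F3; try by rewrite /F ?inE.
by move=> h; exists u, v, w.
Qed.

Let F_None s : None \in s -> F s = false.
Proof. by rewrite /F => ->; rewrite andbF. Qed.

Let edge3_neq (u v w : V) :
  [set u; v; w] \in E -> [/\ u != v, u != w & v != w].
Proof.
move=> /hedge_uniform; rewrite setUC cardsU1 cards2 !inE.
by rewrite !(eq_sym w); case: (u == v); case: (u == w); case: (v == w).
Qed.

Let edge_pair e f (i j : V) : e \in E -> f \in E -> i != j ->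
  [set i; j] \subset e -> [set i; j] \subset f -> e = f.
Proof.
move=> eE fE ij ie jf; apply/eqP/negPn/negP => /(hedge_linear eE fE).
apply/negP; rewrite -ltnNge; have <-: #|[set i; j]| = 2 by rewrite cards2 ij.
by apply: subset_leq_card; rewrite subsetI ie.
Qed.

Let pair_unique (i j x w : V) :
  [set i; j; x] \in E -> [set i; j; w] \in E -> x = w.
Proof.
move=> h1 h2; have [ij ix jx] := edge3_neq h1.
have e := edge_pair h1 h2 ij (subsetUl _ _) (subsetUl _ _).
have : x \in [set i; j; w] by rewrite -e !inE eqxx orbT.
by rewrite !inE eq_sym (negPf ix) eq_sym (negPf jx) => /eqP.
Qed.

Let edge_split2 e (u v : V) : e \in E -> u \in e -> v \in e -> u != v ->
  exists w, e = [set u; v; w].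
Proof.
move=> eE ue ve uv; have := hedge_uniform eE.
rewrite (cardsD1 u) ue (cardsD1 v) !inE eq_sym uv ve => -[] /eqP.
move/cards1P => [w ew]; exists w; rewrite -ew; apply/setP => x; rewrite !inE.
case: (eqVneq x u) => [->|_] /=; first by rewrite ue.
by case: (eqVneq x v) => [->|_] /=; first by rewrite ve.
Qed.

Let edge_split1 (u : V) : exists v w, [set u; v; w] \in E.
Proof.
have [e eE ue] := hedge_cover u; have := hedge_uniform eE.
rewrite (cardsD1 u) ue add1n => -[c]; have : 0 < #|e :\ u| by rewrite c.
case/card_gt0P => v; rewrite !inE eq_sym => /andP[uv ve].
by have [w ew] := edge_split2 eE ue ve uv; exists v, w; rewrite -ew.
Qed.

Let F_pair (u v : V) r : F (Some u :: Some v :: r) ->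
  exists2 w, r = [:: Some w] & [set u; v; w] \in E.
Proof. by move=> /F_inv[a [b [w [[-> -> ->] h]]]]; exists w. Qed.

Let linked_F (i j r l : V) s : linked [set i; j] [set r; l] ->
  F (Some i :: Some j :: s) -> F (Some r :: Some l :: s).
Proof.
case/and3P => _ _ /existsP[w /and3P[_ h1 h2]] /F_pair[x -> h].
by rewrite F3 (pair_unique h (w := w)) setUC.
Qed.

Let linkedC (s t : {set V}) : linked s t -> linked t s.
Proof.
case/and3P => hs ht /existsP[w /and3P[h1 h2 h3]]; apply/and3P; split => //.
by apply/existsP; exists w; rewrite setUC h1 h2 h3.
Qed.

Let F_rel s t r : hyp_rel s t -> F (tos s ++ r) = F (tos t ++ r).
Proof.
have F0 : F (None :: r) = false by rewrite F_None // inE.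
case=> [u v|u|u||u v h|u v h uvh|i j k l h|u v w u' v' w' h h'];
  rewrite /tos /= ?F0 //; try by rewrite F_None // !inE.
- by apply/F_perm/permPl/(perm_catCA [:: Some u] [:: Some v] r).
- apply/negP => /F_pair[w _ e]; have [uv _ _] := edge3_neq e.
  case: h => [uv'|/negP[]]; first by rewrite uv' eqxx in uv.
  apply/andP; split; first by apply/set0Pn; exists u; rewrite !inE eqxx.
  by apply/existsP; exists [set u; v; w]; rewrite e subsetUl.
- by apply/negP => /F_inv[a [b [c [[<- <- <- _] e]]]]; rewrite e in uvh.
- by apply/idP/idP; apply: linked_F => //; apply: linkedC.
- by case: r {F0} => [|o r]; [rewrite !F3 h h' | rewrite /F].
Qed.

Let F_cong s t : cong hyp_rel s t -> forall r, F (tos s ++ r) = F (tos t ++ r).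
Proof.
elim=> {s t} [s t h r|//|s t _ h r|s t u _ h1 _ h2 r|s s' t t' _ h1 _ h2 r].
- exact: F_rel.
- by rewrite h.
- by rewrite h1 h2.
- rewrite (tosM s t) (tosM s' t') -2!catA h1 F_swap h2.
  exact: F_swap.
Qed.

Let zero_l s : cong hyp_rel (None, s) gen0.
Proof.
elim/last_ind: s => [|s o IH]; first exact: cong_refl.
rewrite -cats1; apply: cong_trans (cong_mul IH (cong_refl _ (letter o))) _.
apply: cong_rel.
by case: o => [u|]; [apply: hyp_0l|apply: hyp_00].
Qed.

Let zero_letter o : cong hyp_rel (letter o * gen0) gen0.
Proof. by apply: cong_rel; case: o => [u|]; [apply: hyp_0r|apply: hyp_00]. Qed.

Let zero_cons o (s : hword) :
  cong hyp_rel s gen0 -> cong hyp_rel (letter o * s) gen0.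
Proof. by move=> h; apply: cong_trans (cong_mul (cong_refl _ _) h) (zero_letter o). Qed.

Let zero_r (s : hword) : cong hyp_rel (s * gen0) gen0.
Proof.
case: s => o s; elim: s o => [|o' s IH] o; first exact: zero_letter.
exact: (zero_cons o (IH o')).
Qed.

Let zero_in (s : hword) : None \in tos s -> cong hyp_rel s gen0.
Proof.
case: s => o s; elim: s o => [|o' s IH] [u|] h; try exact: zero_l.
- by rewrite inE in h.
- by apply: (@zero_cons (Some u) (o', s)); apply: IH; rewrite inE in h.
Qed.

Let zero_cat (s t : hword) :
  cong hyp_rel s gen0 -> cong hyp_rel (s * t) gen0.
Proof.
by move=> h; apply: cong_trans (cong_mul h (cong_refl _ t)) _; apply: zero_l.
Qed.

Let zero_pre o s s' :
  cong hyp_rel (o, s) gen0 -> cong hyp_rel (o, s ++ s') gen0.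
Proof.
case: s' => [|o' s'] h; first by rewrite cats0.
exact: (@zero_cat (o, s) (o', s')).
Qed.

Let zero4 (u v h k : V) : cong hyp_rel (gen u * gen v * gen h * gen k) gen0.
Proof.
case: (boolP ([set u; v; h] \in E)) => [e1|n1]; last first.
  by apply: zero_cat; apply: cong_rel; apply: hyp_triple0.
case: (boolP ([set v; h; k] \in E)) => [e2|n2]; last first.
  by rewrite -!mulgA; apply: zero_cons; apply: cong_rel; rewrite mulgA; apply: hyp_triple0.
have <- : u = k.
  by apply: (@pair_unique v h) => //; rewrite setUC setUA.
apply: (@cong_trans _ _ _ (gen v * (gen u * gen u * gen h))).
  exact: (cong_mul (cong_rel (hyp_comm u v)) (cong_rel (hyp_comm h u))).
apply: zero_cons; apply: zero_cat; apply: cong_rel; apply: hyp_pair0.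
by left.
Qed.

Let nonzero_F (s : hword) :
  ~ cong hyp_rel s gen0 -> exists p, F (tos s ++ p).
Proof.
move=> n0; have : None \notin tos s by apply/negP => /zero_in.
case: s n0 => -[u|] [|[v|] [|[h|] [|[k|] s]]] //= n0 _.
- by have [v [w e]] := edge_split1 u; exists [:: Some v; Some w]; rewrite F3.
- case: (eqVneq u v) => [uv|uv].
    by case: n0; apply: cong_rel; apply: (@hyp_pair0 u v); left.
  case: (boolP (subhyperedge [set u; v])) => [|ns]; last first.
    by case: n0; apply: cong_rel; apply: (@hyp_pair0 u v); right.
  case/andP => _ /existsP[e /andP[eE /subsetP sub]].
  have [||w ew] := edge_split2 eE _ _ uv; try by apply: sub; rewrite !inE eqxx ?orbT.
  by exists [:: Some w]; rewrite F3 -ew.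
- case: (boolP ([set u; v; h] \in E)) => [e|ne]; first by exists [::]; rewrite F3.
  by case: n0; apply: cong_rel; apply: (@hyp_triple0 u v h).
- case: n0; exact: (@zero_pre (Some u) [:: Some v; Some h; Some k] s (zero4 u v h k)).
Qed.

Let F_cancel (x y t : hword) p :
  F (tos x ++ tos y ++ p) -> F (tos x ++ tos t ++ p) -> cong hyp_rel y t.
Proof.
move=> /F_inv[a [b [c [e1 h1]]]] /F_inv[a' [b' [c' [e2 h2]]]].
move: e1 e2; rewrite /tos; case: x y t => [ox [|ox' sx]] [oy sy] [ot st] /=.
- case: sy => [|oy' sy] /=; case: st => [|ot' st] /=.
  + move=> [-> -> ->] [aa -> cc]; rewrite aa cc in h1 *.
    rewrite setUAC in h1; rewrite setUAC in h2.
    by rewrite (pair_unique h1 h2); apply: cong_refl.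
  + by move=> [_ _ ->] [_ _ _]; case: st.
  + by move=> [_ _ _ e] [_ _ e']; case: sy e => //=; rewrite e'.
  + case: sy => [|? ?] //; case: st => [|? ?] // [-> -> -> _] [aa -> -> _].
    rewrite aa in h1 *; apply: cong_rel; apply: (@hyp_linked b c b' c').
    have sub (i j k : V) : [set i; j; k] \in E -> subhyperedge [set j; k].
      move=> h; apply/andP; split; first by apply/set0Pn; exists j; rewrite !inE eqxx.
      by apply/existsP; exists [set i; j; k]; rewrite h -setUA subsetUr.
    rewrite /linked (sub _ _ _ h1) (sub _ _ _ h2) /=; apply/existsP; exists a'.
    rewrite !setUA h1 h2 !inE; have [n1 n2 _] := edge3_neq h1.
    by have [n3 n4 _] := edge3_neq h2; rewrite !negb_or n1 n2 n3 n4.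
- case: sx => [|? [|]] //=; case: sy => [|? [|]] //; case: st => [|? [|]] //.
  move=> [-> -> -> _] [aa bb -> _]; rewrite aa bb in h1.
  by rewrite (pair_unique h1 h2); apply: cong_refl.
Qed.

Definition hyp_semigroup : semigroupType := presented_semigroup hyp_rel.
Definition hyp0 : hyp_semigroup := \pi_(quot_semigroup hyp_rel) gen0.

Let hyp0E (s : hword) :
  (\pi_(quot_semigroup hyp_rel) s : hyp_semigroup) = hyp0 <->
  cong hyp_rel s gen0.
Proof. exact: quot_eqP. Qed.

Fact hyp0_zero : is_zero hyp0.
Proof.
split=> x; rewrite -[x]reprK /hyp0 -quotM; apply/quot_eqP; last exact: zero_r.
exact: zero_l.
Qed.

Fact hyp_zero_cancellative : zero_cancellative hyp0.
Proof.
split=> x y t; rewrite -[x]reprK -[y]reprK -[t]reprK -!quotM.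
  move=> /quot_eqP e n0; apply/quot_eqP.
  have [p Fp] : exists p, F (tos (repr x * repr y) ++ p).
    by apply: nonzero_F => /hyp0E.
  have Fp' := Fp; rewrite (F_cong e) in Fp'.
  by apply: (@F_cancel (repr x) _ _ p); rewrite catA.
move=> /quot_eqP e n0; apply/quot_eqP.
have [p Fp] : exists p, F (tos (repr y * repr x) ++ p).
  by apply: nonzero_F => /hyp0E.
have Fp' := Fp; rewrite (F_cong e) in Fp'.
by apply: (@F_cancel (repr x) _ _ p); rewrite F_swap catA.
Qed.

(** The presentation does not collapse the common value a of the products over
    hyperedges. *)
Lemma hyp_edge_neq0 (u v w : V) : [set u; v; w] \in E ->
  (\pi_(quot_semigroup hyp_rel) (gen u * gen v * gen w) : hyp_semigroup) <> hyp0.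
Proof.
move=> e /hyp0E /F_cong /(_ [::]); rewrite /= F3 e => /esym.
by rewrite F_None // inE.
Qed.

Definition hyp_semiring : semiring :=
  flat_semiring hyp0_zero hyp_zero_cancellative.

End HypergraphSemiring.

Section Sc.
Local Open Scope group_scope.
Local Open Scope mset_scope.
Variables (K : choiceType) (w : {mset K}).

(** Words in the free commutative semigroup are nonempty multisets of letters;
    [None] is the new element 0. *)
Definition subword : Type := {m : {mset K} | (m != mset0) && (m `<=` w)}.
HB.instance Definition _ :=
  Choice.copy subword {m : {mset K} | (m != mset0) && (m `<=` w)}.

Definition Sc_carrier : Type := option subword.
HB.instance Definition _ := Choice.copy Sc_carrier (option subword).

Definition Sc_mul (x y : Sc_carrier) : Sc_carrier :=
  if (x, y) is (Some u, Some v) then insub (val u `+` val v) else None.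

Let mset_add_eq0 (A B : {mset K}) : A `+` B = mset0 -> A = mset0.
Proof.
move=> /msetP AB; apply/msetP => x; have := AB x.
by rewrite msetE2 !mset0E; case: (A x).
Qed.

Let add_ok (A B : {mset K}) : A != mset0 ->
  (A `+` B != mset0) && (A `+` B `<=` w) -> (A != mset0) && (A `<=` w).
Proof.
move=> A0 /andP[_ /msubsetP AB]; rewrite A0; apply/msubsetP => x.
by apply: leq_trans (AB x); rewrite msetE2 leq_addr.
Qed.

Let insub_mul (A B : {mset K}) : A != mset0 -> B != mset0 ->
  Sc_mul (insub A) (insub B) = insub (A `+` B).
Proof.
move=> A0 B0; rewrite /Sc_mul; case: insubP => [u _ ->|nA]; last first.
  by rewrite insubN //; apply: contra nA; apply: add_ok.
case: insubP => [v _ -> //|nB]; rewrite insubN //; apply: contra nB.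
by rewrite msetDC; apply: add_ok.
Qed.

Fact Sc_mulA : associative Sc_mul.
Proof.
have S0 x : Sc_mul x None = None by case: x.
have sub0 (u : subword) : val u != mset0 by case/andP: (valP u).
have add0 (A B : {mset K}) : A != mset0 -> A `+` B != mset0.
  by apply: contra => /eqP/mset_add_eq0/eqP.
case=> [u|] // [v|] //= [t|] //=; rewrite ?S0 //.
rewrite -[Some u]valK -[Some v]valK -[Some t]valK.
by rewrite !insub_mul ?add0 ?sub0 // msetDA.
Qed.

HB.instance Definition _ := isSemigroup.Build Sc_carrier Sc_mulA.

Definition Sc0 : Sc_carrier := None.

Fact Sc0_zero : is_zero Sc0.
Proof. by split=> -[]. Qed.

Let Sc_mulC (x y : Sc_carrier) : x * y = y * x.
Proof. by case: x y => [u|] [v|] //; rewrite /mul /= /Sc_mul msetDC. Qed.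

Fact Sc_zero_cancellative : zero_cancellative Sc0.
Proof.
have h x y t : x * y = x * t -> x * y <> Sc0 -> y = t.
  case: x y t => [u|] [v|] [t|] //=; rewrite /mul /= /Sc_mul.
  case: insubP => [s _ es|] //; case: insubP => [s' _ es'|] //.
  move=> [ss'] _; congr Some; apply: val_inj.
  by apply: (can_inj (msetDKB (val u))); rewrite /= -es -es' ss'.
by split=> x y t; last rewrite !(Sc_mulC _ x); apply: h.
Qed.

Definition Sc_semiring : semiring :=
  flat_semiring Sc0_zero Sc_zero_cancellative.

End Sc.

(* Main.v *)
(** A 2-robustly strong 3-colorable hypergraph is determined by its colorings.
    Evaluate a word over the vertices in the power of [S_c(abc)] indexed
    by all strong 3-colorings, sending a vertex to the tuple of its
    colors, and collapse the tuples with a zero coordinate. Robustness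
    says that distinct vertices are separated by some coloring and that a
    pair which is not a subhyperedge is monochromatic in some coloring; so
    two words have the same image if and only if they are equal in the
    3-hypergraph semigroup, and [S_H] is a quotient of a subalgebra of the
    power. Since the sum of two distinct tuples has a zero coordinate, the
    quotient map also respects the flat addition. Conversely, the three
    vertices of one edge generate a copy of [S_c(abc)] in [S_H]: in both,
    a product of generators is nonzero exactly when they are pairwise
    distinct, and then it determines the set of its factors. *)
Require Import Defs.
From mathcomp Require Import all_boot.
From mathcomp Require Import finmap multiset.
From mathcomp Require Import boolp.

Set Implicit Arguments.
Unset Strict Implicit.
Unset Printing Implicit Defensive.

(** * Varieties generated by one semiring *)

Lemma variety_gen_trans (S A B : semiring) :
  variety_gen S A -> variety_gen A B -> variety_gen S B.
Proof. by move=> SA AB K Kvar KS; apply: AB => //; apply: SA. Qed.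

(** The domain of [R] is a subalgebra of the power, and [R] is the graph of a
    homomorphism of it onto [A]. *)
Lemma variety_gen_rel (S A : semiring) (I : Type) (R : (I -> S) -> A -> Prop) :
  (forall t s s', R t s -> R t s' -> s = s') ->
  (forall s, exists t, R t s) ->
  (forall t t' s s', R t s -> R t' s' ->
     R (fun i => sr_add (t i) (t' i)) (sr_add s s')) ->
  (forall t t' s s', R t s -> R t' s' ->
     R (fun i => sr_mul (t i) (t' i)) (sr_mul s s')) ->
  variety_gen S A.
Proof.
move=> Rfun Rtot Radd Rmul K [Kimg Ksub Kprod] KS.
pose dom := {t : I -> S | exists s, R t s}.
(* By proof irrelevance [dom] is a subset of the power, so the semiring laws hold coordinatewise. *)
have dom_inj : injective (sval : dom -> _).
  by move=> [t p] [t' p'] /= e; case: _ / e p' => p'; congr exist.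
have addP (x y : dom) : exists s, R (fun i => sr_add (sval x i) (sval y i)) s.
  case: x y => [t [s ts]] [t' [s' ts']] /=.
  by exists (sr_add s s'); apply: Radd.
have mulP (x y : dom) : exists s, R (fun i => sr_mul (sval x i) (sval y i)) s.
  case: x y => [t [s ts]] [t' [s' ts']] /=.
  by exists (sr_mul s s'); apply: Rmul.
pose add (x y : dom) : dom := exist _ _ (addP x y).
pose mul (x y : dom) : dom := exist _ _ (mulP x y).
have ne : exists x : dom, True.
  have [s _] := sr_nonempty A; have [t ts] := Rtot s.
  by exists (exist _ t (ex_intro _ s ts)).
have addA : associative add.
  by move=> x y u; apply: dom_inj; apply: funext => i; apply: sr_addA.
have addC : commutative add.
  by move=> x y; apply: dom_inj; apply: funext => i; apply: sr_addC.
have mulA : associative mul.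
  by move=> x y u; apply: dom_inj; apply: funext => i; apply: sr_mulA.
have mulDl : left_distributive mul add.
  by move=> x y u; apply: dom_inj; apply: funext => i; apply: sr_mulDl.
have mulDr : right_distributive mul add.
  by move=> x y u; apply: dom_inj; apply: funext => i; apply: sr_mulDr.
pose D := Semiring ne addA addC mulA mulDl mulDr.
pose f (x : D) : A := sval (cid (svalP x)).
have fP (x : D) : R (sval x) (f x) by rewrite /f; case: cid.
have KD : K D.
  apply: (Ksub D (product_semiring (fun _ : I => S)) (sval : dom -> _)) => //.
  exact: Kprod.
apply: (Kimg D A f) => //.
  split=> x y; apply: Rfun (fP _) _; first exact: Radd.
  exact: Rmul.
move=> s; have [t ts] := Rtot s; exists (exist _ t (ex_intro _ s ts)).
exact: Rfun (fP _) _.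
Qed.

Lemma eq_variety_gen (A B : semiring) :
  variety_gen A B -> variety_gen B A -> variety_gen A = variety_gen B.
Proof.
move=> AB BA; apply: funext => C; apply: propext.
by split; apply: variety_gen_trans.
Qed.

(** * Products of words in a semigroup *)

Section WordProduct.
Local Open Scope group_scope.

Definition word_seq (X : choiceType) (w : free_semigroup X) : seq X :=
  w.1 :: w.2.

Variables (X : choiceType) (S : semigroupType) (f : X -> S).

Definition wprod (w : free_semigroup X) : S :=
  foldl (fun p y => p * f y) (f w.1) w.2.

Lemma wprodM w w' : wprod (w * w') = wprod w * wprod w'.
Proof.
case: w w' => [x s] [y t]; rewrite /wprod /= foldl_cat /=.
by elim/last_ind: t => [//|t u IH]; rewrite !foldl_rcons IH mulgA.
Qed.

Lemma perm_wprod w w' : commutative (@mul S) ->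
  perm_eq (word_seq w) (word_seq w') -> wprod w = wprod w'.
Proof.
move=> mulC ww'.
(* [oAC] adjoins [None] as a unit, so that permutation of big operators applies to nonempty
   products. *)
have bigE v : Some (wprod v) =
    \big[oAC (@mulgA S) mulC/None]_(x <- word_seq v) Some (f x).
  case: v => x s; rewrite /word_seq /wprod /=.
  elim/last_ind: s => [|s y IH]; first by rewrite big_seq1.
  by rewrite -rcons_cons big_rcons foldl_rcons -IH /=.
by apply: Some_inj; rewrite !bigE (perm_big _ ww').
Qed.

End WordProduct.

Lemma not_uniq_perm (T : eqType) (s : seq T) : ~~ uniq s ->
  exists x r, perm_eq s (x :: x :: r).
Proof.
elim: s => [//|y s IH] /=; rewrite negb_and negbK.
case/orP => [ys|/IH[x [r sr]]].
  by exists y, (rem y s); rewrite perm_cons perm_to_rem.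
exists x, (y :: r); rewrite -(perm_cons y) in sr; apply: perm_trans sr _.
exact/permPl/(perm_catCA [:: y] [:: x; x] r).
Qed.

(** * Three commuting square-zero elements with nonzero product *)

Section Frame.
Local Open Scope group_scope.

(** What the letters of [S_c(abc)] and the vertices of an edge have in common. Every product of
    distinct [x i] divides the full product, hence is nonzero too. *)
Record frame (S : semigroupType) (z : S) (x : 'I_3 -> S) : Prop := Frame {
  frame_zero : is_zero z;
  frame_mulC : commutative (@mul S);
  frame_sqr : forall i, x i * x i = z;
  frame_top : x (inord 0) * x (inord 1) * x (inord 2) <> z }.

Variables (S : semigroupType) (z : S) (x : 'I_3 -> S).
Hypothesis xP : frame z x.

(** A repeated letter moves to the front, where its square is zero; a word without repetition is
    completed by its missing letters [t] to the full product. *)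
Lemma frame_wprod_eq0 w : wprod x w = z <-> ~~ uniq (word_seq w).
Proof.
have [z0 mulC sqr top] := xP.
have foldz s : foldl (fun p y => p * x y) z s = z.
  by elim: s => //= y s IH; rewrite z0.1.
split=> [wz|/not_uniq_perm[i [r wr]]]; last first.
  by rewrite (perm_wprod (w' := (i, i :: r)) _ mulC wr) /wprod /= sqr foldz.
apply/negP => wu; apply: top.
pose t := [seq i <- enum 'I_3 | i \notin word_seq w].
have /(perm_wprod x mulC) : perm_eq (word_seq (w.1, w.2 ++ t))
    (word_seq (inord 0, [:: inord 1; inord 2])).
  apply: uniq_perm.
  - rewrite /word_seq -cat_cons cat_uniq wu filter_uniq ?enum_uniq // andbT /=.
    by apply/hasPn => i; rewrite mem_filter => /andP[].
  - by rewrite /= !inE -!(inj_eq val_inj) /= !inordK.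
  move=> i; rewrite /word_seq -cat_cons mem_cat mem_filter mem_enum andbT orbN.
  by rewrite !inE -!(inj_eq val_inj) /= !inordK //; case: i => [[|[|[|]]]].
rewrite {2}/wprod /= => <-; move: wz; rewrite /wprod /= foldl_cat => ->.
exact: foldz.
Qed.

Lemma frame_wprod_inj w w' : uniq (word_seq w) -> wprod x w = wprod x w' ->
  perm_eq (word_seq w) (word_seq w').
Proof.
have sub v v' i : uniq (word_seq v') -> wprod x v = wprod x v' ->
    i \in word_seq v -> i \in word_seq v'.
  move=> u' vv' iv; apply/negPn/negP => niv'.
  (* Multiplying by [x i] kills the product of [v], in which [i] occurs, hence also that of [v'], in
     which it does not. *)
  suff : ~~ uniq (i :: word_seq v') by rewrite cons_uniq niv' u'.
  apply/(frame_wprod_eq0 (letter i * v')); rewrite wprodM -vv' -wprodM.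
  by apply/frame_wprod_eq0; rewrite [uniq _](cons_uniq i (word_seq v)) iv.
move=> u ww'; have u' : uniq (word_seq w').
  apply/negPn/negP => /frame_wprod_eq0.
  by rewrite -ww' => /frame_wprod_eq0/negP.
by apply: uniq_perm => // i; apply/idP/idP; apply: sub.
Qed.

End Frame.

(** Equality of two products depends on the words alone: either both repeat a letter, or neither
    does and they are permutations of each other. *)
Lemma frame_wprod_transfer (S S' : semigroupType) (z : S) (z' : S') x x' :
  frame z x -> frame z' x' -> forall w w',
  wprod x w = wprod x w' -> wprod x' w = wprod x' w'.
Proof.
move=> xP x'P w w' e; case: (boolP (uniq (word_seq w))) => [u|nu].
  exact: perm_wprod (frame_mulC x'P) (frame_wprod_inj xP u e).
have wz : wprod x w = z by apply/(frame_wprod_eq0 xP).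
have /(frame_wprod_eq0 x'P) -> := nu; apply/esym/(frame_wprod_eq0 x'P).
by apply/(frame_wprod_eq0 xP); rewrite -e.
Qed.

Lemma flat_semiring_add (S : semigroupType) (z : S) (z0 : is_zero z)
    (zc : zero_cancellative z) (x y : flat_semiring z0 zc) :
  sr_add x y = if x == y :> S then x else z.
Proof. by []. Qed.

Lemma frame_variety_gen (S S' : semigroupType) (z : S) (z' : S')
    (z0 : is_zero z) (zc : zero_cancellative z)
    (z0' : is_zero z') (zc' : zero_cancellative z') x x' :
  frame z x -> frame z' x' -> (forall s, exists w, s = wprod x' w) ->
  variety_gen (flat_semiring z0 zc) (flat_semiring z0' zc').
Proof.
move=> xP x'P gen'.
(* The power indexed by [unit] is the semiring itself; [R] matches the values of a word under [x]
   and [x']. *)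
pose R (t : unit -> flat_semiring z0 zc) (s : flat_semiring z0' zc') :=
  exists2 w, t tt = wprod x w & s = wprod x' w.
apply: (variety_gen_rel (R := R)).
- move=> t s s' [w tw ->] [w' tw' ->].
  by apply: (frame_wprod_transfer xP x'P); rewrite -tw -tw'.
- by move=> s; have [w ->] := gen' s; exists (fun=> wprod x w), w.
- move=> t t' s s' [w tw ->] [w' tw' ->]; rewrite /R !flat_semiring_add tw tw'.
  have -> : (wprod x' w == wprod x' w') = (wprod x w == wprod x w').
    by apply/eqP/eqP; [apply: (frame_wprod_transfer x'P xP)
                      |apply: (frame_wprod_transfer xP x'P)].
  case: ifP => _; first by exists w => //.
  (* Distinct values add up to the zero, which is the value of a square. *)
  exists (ord0, [:: ord0]); first by rewrite /wprod /= (frame_sqr xP).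
  by rewrite /wprod /= (frame_sqr x'P).
- move=> t t' s s' [w tw ->] [w' tw' ->]; exists (w * w')%g; rewrite wprodM //.
  by rewrite -tw -tw'.
Qed.

(** * The letters of [S_c(abc)] *)

Section ScFrame.
Local Open Scope group_scope.
Local Open Scope mset_scope.

(** A multiset that does not divide [w] has no multiple dividing [w], so [insub], which sends
    non-divisors to 0, is multiplicative. *)
Lemma Sc_insubM (K : choiceType) (w A B : {mset K}) :
  A != mset0 -> B != mset0 ->
  (insub A : Sc_carrier w) * insub B = insub (A `+` B).
Proof.
move=> A0 B0; rewrite /mul /= /Sc_mul.
have subl (C D : {mset K}) : C != mset0 ->
    (C `+` D != mset0) && (C `+` D `<=` w) -> (C != mset0) && (C `<=` w).
  move=> -> /andP[_ /msubsetP CD]; apply/msubsetP => y.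
  by apply: leq_trans (CD y); rewrite msetE2 leq_addr.
case: insubP => [u _ ->|nA]; last first.
  by rewrite insubN //; apply: contra nA; apply: subl.
case: insubP => [v _ -> //|nB]; rewrite insubN //; apply: contra nB.
by rewrite msetDC; apply: subl.
Qed.

Lemma Sc_wprod (K X : choiceType) (w : {mset K}) (l : X -> K)
    (v : free_semigroup X) :
  wprod (fun i => insub [mset l i] : Sc_carrier w) v =
  insub (seq_mset [seq l i | i <- word_seq v]).
Proof.
case: v => i s; rewrite /wprod /word_seq /=.
elim/last_ind: s => [|s j IH] /=.
  congr insub; apply/msetP => y.
  by rewrite mset_seqE msetnE /= addn0 eq_sym; case: eqP.
rewrite foldl_rcons IH Sc_insubM.
- congr insub; apply/msetP => y; rewrite msetE2 !mset_seqE msetnE map_rcons /=.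
  by rewrite -cats1 count_cat /= addn0 addnA (eq_sym y); case: eqP.
- by apply/eqP => /msetP/(_ (l i)); rewrite mset_seqE mset0E /= eqxx.
- by apply/eqP => /msetP/(_ (l j)); rewrite msetnE mset0E eqxx.
Qed.

Variables (K : choiceType) (a b c : K).
Hypothesis abc : uniq [:: a; b; c].
Let w := [mset a; b; c].
Let l (i : 'I_3) := nth a [:: a; b; c] i.

Let wE y : w y = (y \in [:: a; b; c]).
Proof.
rewrite -(count_uniq_mem y abc) /w !msetE2 !msetnE /= addn0 !(eq_sym y) addnA.
by do 3!case: eqP.
Qed.

Let l_enum : [seq l i | i <- enum 'I_3] = [:: a; b; c].
Proof. by rewrite /l (map_comp (nth a _) val) val_enum_ord. Qed.

Definition Sc_letter (i : 'I_3) : Sc_carrier w := insub [mset l i].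

(** A square exceeds the multiplicity one of its letter in [w], and the full product is [w]
    itself. *)
Lemma Sc_frame : frame (Sc0 w) Sc_letter.
Proof.
split.
- exact: Sc0_zero.
- by case=> [u|] [v|] //; rewrite /mul /= /Sc_mul msetDC.
- move=> i; have := Sc_wprod w l (i, [:: i]); rewrite /wprod /= => ->.
  apply: insubN; apply/negP => /andP[_ /msubsetP/(_ (l i))].
  by rewrite wE mset_seqE /= eqxx; case: (_ \in _).
have := Sc_wprod w l (inord 0, [:: inord 1; inord 2]); rewrite /wprod /= => ->.
rewrite [seq_mset _](_ : _ = w); last first.
  by apply/msetP => y; rewrite mset_seqE wE /l !inordK // count_uniq_mem.
case: insubP => //; rewrite msubset_refl andbT negbK => /eqP w0 _.
by have := wE a; rewrite w0 mset0E inE eqxx.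
Qed.

Lemma Sc_wprod_surj (s : Sc_carrier w) : exists v, s = wprod Sc_letter v.
Proof.
case: s => [m|]; last first.
  exists (ord0, [:: ord0]); rewrite /wprod /=.
  by rewrite (frame_sqr Sc_frame).
case/andP: (valP m) => m0 /msubsetP mw.
(* Multiplicities are at most one, so a nonzero element is determined by the letters occurring in
   it. *)
have tE : val m = seq_mset [seq l i | i <- enum 'I_3 & l i \in val m].
  apply/msetP => y; rewrite -filter_map l_enum mset_seqE.
  rewrite (count_uniq_mem _ (filter_uniq _ abc)) mem_filter /= in_mset.
  by have := mw y; rewrite wE; case: (y \in _); case: (val m y) => [|[|]].
case: [seq i <- enum _ | _] tE => [|i t] tE.
  by case/eqP: m0; rewrite tE; apply/msetP => y; rewrite mset_seqE mset0E.
by exists (i, t); rewrite Sc_wprod -tE valK.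
Qed.

End ScFrame.

(** * Three colors and the edges of a linear hypergraph *)

Lemma uniq3_perm (p q r p' q' r' : 'I_3) : uniq [:: p; q; r] ->
  uniq [:: p'; q'; r'] -> perm_eq [:: p; q; r] [:: p'; q'; r'].
Proof.
have full (s : seq 'I_3) : size s = 3 -> uniq s -> s =i 'I_3.
  move=> s3 su; apply/subset_cardP; last exact/subsetP.
  by rewrite (card_uniqP su) s3 card_ord.
by move=> u u'; apply: uniq_perm => // i; rewrite !full.
Qed.

Section Hypergraph.
Local Open Scope group_scope.
Local Open Scope quotient_scope.
Variable H : hypergraph3.
Notation V := (vertex H).
Notation E := (hedge H).
Notation hword := (free_semigroup (option V)).

Lemma edge3_uniq (u v w : V) : [set u; v; w] \in E -> uniq [:: u; v; w].
Proof.
move=> /hedge_uniform; rewrite setUC cardsU1 cards2 /= !inE.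
by rewrite !(eq_sym w); case: (u == v); case: (u == w); case: (v == w).
Qed.

Lemma edge_pair_unique (u v x y : V) :
  [set u; v; x] \in E -> [set u; v; y] \in E -> x = y.
Proof.
move=> h1 h2; have := edge3_uniq h1; rewrite /= !inE negb_or andbT.
move=> /andP[/andP[uv ux] vx].
have e : [set u; v; x] = [set u; v; y].
  apply/eqP/negPn/negP => /(hedge_linear h1 h2); apply/negP; rewrite -ltnNge.
  have <- : #|[set u; v]| = 2 by rewrite cards2 uv.
  by apply: subset_leq_card; rewrite subsetI !subsetUl.
have : x \in [set u; v; y] by rewrite -e !inE eqxx orbT.
by rewrite !inE eq_sym (negPf ux) eq_sym (negPf vx) => /eqP.
Qed.

Lemma edge_split2 (e : {set V}) (u v : V) : e \in E -> u \in e -> v \in e ->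
  u != v -> exists w, e = [set u; v; w].
Proof.
move=> eE ue ve uv; have := hedge_uniform eE.
rewrite (cardsD1 u) ue (cardsD1 v) !inE eq_sym uv ve => -[] /eqP.
move/cards1P => [w ew]; exists w; rewrite -ew; apply/setP => x; rewrite !inE.
case: (eqVneq x u) => [->|_] /=; first by rewrite ue.
by case: (eqVneq x v) => [->|_] /=; first by rewrite ve.
Qed.

Lemma subhyperedge2P (u v : V) : u != v ->
  reflect (exists w, [set u; v; w] \in E) (subhyperedge [set u; v]).
Proof.
move=> uv; apply: (iffP andP) => [[_ /existsP[e /andP[eE /subsetP sub]]]|[w e]].
  have [||w ew] := edge_split2 eE _ _ uv;
    try by apply: sub; rewrite !inE eqxx ?orbT.
  by exists w; rewrite -ew.
split; first by apply/set0Pn; exists u; rewrite !inE eqxx.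
by apply/existsP; exists [set u; v; w]; rewrite e subsetUl.
Qed.

Lemma linkedP (i j r l w : V) :
  [set i; j; w] \in E -> [set r; l; w] \in E -> linked [set i; j] [set r; l].
Proof.
move=> h1 h2; have := edge3_uniq h1; have := edge3_uniq h2.
rewrite /= !inE !negb_or !andbT.
move=> /andP[/andP[rl rw] lw] /andP[/andP[ij iw] jw].
apply/and3P; split; try by apply/subhyperedge2P => //; exists w.
apply/existsP; exists w.
rewrite [w |: [set i; j]]setUC [w |: [set r; l]]setUC h1 h2.
by rewrite !inE !negb_or !(eq_sym w) iw jw rw lw.
Qed.

(** * Multiplication in the hypergraph semigroup *)

Notation pi := (\pi_(quot_semigroup (@hyp_rel H)) : hword -> hyp_semigroup H).
Notation A u := (pi (gen u)).

Lemma hyp_relE (s t : hword) : hyp_rel s t -> pi s = pi t.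
Proof. by move=> st; apply/quot_eqP; apply: cong_rel. Qed.

Lemma hyp_piM (s t : hword) : pi (s * t) = pi s * pi t.
Proof. exact: quotM. Qed.

Lemma hyp_pi_rcons o s o' : pi (o, rcons s o') = pi (o, s) * pi (letter o').
Proof. by rewrite -cats1; exact: (hyp_piM (o, s) (letter o')). Qed.

(** The presentation makes only generators commute; this moves one letter past a word, and
    [hyp_mulC] repeats it letter by letter. *)
Lemma hyp_genC o (s : hword) : pi (letter o) * pi s = pi s * pi (letter o).
Proof.
have [z0l z0r] := hyp0_zero H.
case: o => [u|]; last by rewrite z0l z0r.
case: s => o s; elim/last_ind: s => [|s o' IH].
  case: o => [v|]; last by rewrite z0l z0r.
  by rewrite -!hyp_piM; apply/hyp_relE/hyp_comm.
rewrite hyp_pi_rcons mulgA IH -!mulgA; congr (_ * _).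
case: o' => [v|]; last by rewrite z0l z0r.
by rewrite -!hyp_piM; apply/hyp_relE/hyp_comm.
Qed.

Lemma hyp_mulC : commutative (@mul (hyp_semigroup H)).
Proof.
move=> x y; rewrite -[x]reprK -[y]reprK; case: (repr x) => o s.
elim/last_ind: s => [|s o' IH]; first exact: hyp_genC.
by rewrite hyp_pi_rcons -mulgA hyp_genC mulgA IH -!mulgA.
Qed.

Lemma hyp_gen2_eq0 (u v : V) : u = v \/ ~~ subhyperedge [set u; v] ->
  A u * A v = hyp0 H.
Proof. by move=> uv; rewrite -hyp_piM; apply/hyp_relE/hyp_pair0. Qed.

Lemma hyp_gen3_eq0 (u v w : V) : [set u; v; w] \notin E ->
  A u * A v * A w = hyp0 H.
Proof. by move=> h; rewrite -!hyp_piM; apply/hyp_relE/hyp_triple0. Qed.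

(** If both consecutive triples are edges, linearity gives [u = x] and commuting produces a square;
    otherwise one triple is already zero. *)
Lemma hyp_gen4_eq0 (u v w x : V) : A u * A v * A w * A x = hyp0 H.
Proof.
have [z0l z0r] := hyp0_zero H.
case: (boolP ([set u; v; w] \in E)) => [e1|/hyp_gen3_eq0 ->]; last exact: z0l.
case: (boolP ([set v; w; x] \in E)) => [e2|/hyp_gen3_eq0 h]; last first.
  by rewrite -2!mulgA [A v * _]mulgA h z0r.
have <- : u = x by apply: (@edge_pair_unique v w) => //; rewrite setUC setUA.
by rewrite hyp_mulC !mulgA hyp_gen2_eq0 ?z0l //; left.
Qed.

Lemma hyp_frame (u v w : V) : [set u; v; w] \in E ->
  frame (hyp0 H) (fun i => A (nth u [:: u; v; w] i)).
Proof.
move=> e; split; [exact: hyp0_zero|exact: hyp_mulC| |].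
  by move=> i; apply: hyp_gen2_eq0; left.
rewrite !inordK // -[nth u _ 0]/u -[nth u _ 1]/v -[nth u _ 2]/w -!hyp_piM.
exact: hyp_edge_neq0.
Qed.

(** The words that are not products of distinct vertices of one edge all
    represent [0]. *)
Inductive edge_word : hword -> Prop :=
| edge_word0 : edge_word (gen0 H)
| edge_word1 u : edge_word (gen u)
| edge_word2 u v w : [set u; v; w] \in E -> edge_word (gen u * gen v)
| edge_word3 u v w : [set u; v; w] \in E -> edge_word (gen u * gen v * gen w).

(** By induction on length: appending a letter to an edge word either gives an edge word or makes
    the product zero. *)
Lemma edge_word_repr (s : hword) : exists2 t, edge_word t & pi s = pi t.
Proof.
have [z0l z0r] := hyp0_zero H.
have zero : exists2 t, edge_word t & hyp0 H = pi t.
  by exists (gen0 H); first exact: edge_word0.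
case: s => o s; elim/last_ind: s => [|s o' [t tw st]].
  by case: o => [u|] //; exists (gen u); first exact: edge_word1.
rewrite hyp_pi_rcons st.
case: o' => [x|]; last by rewrite z0r.
case: tw => [|u|u v w e|u v w e]; rewrite ?hyp_piM ?z0l ?hyp_gen4_eq0 //.
- case: (eqVneq u x) => [->|ux]; first by rewrite hyp_gen2_eq0 //; left.
  case: (boolP (subhyperedge [set u; x])) => [/(subhyperedge2P ux)[w e]|n].
    by exists (gen u * gen x); [apply: edge_word2 e|rewrite hyp_piM].
  by rewrite hyp_gen2_eq0 //; right.
- case: (boolP ([set u; v; x] \in E)) => [e'|/hyp_gen3_eq0 -> //].
  by exists (gen u * gen v * gen x); [apply: edge_word3|rewrite !hyp_piM].
Qed.

(** * Strong 3-colorings *)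

Definition coloring : Type := {phi : V -> 'I_3 | strong_3coloring phi}.

Lemma coloring_edge (phi : coloring) u v w : [set u; v; w] \in E ->
  uniq [:: sval phi u; sval phi v; sval phi w].
Proof.
case: phi => phi phiP /= e; have := edge3_uniq e.
rewrite -(map_inj_in_uniq (f := phi)) // => x y.
by rewrite !inE !orbA => xe ye; apply: (phiP _ e); rewrite !inE ?orbA.
Qed.

(** A pair of distinct colors is the complement of the third. This turns a comparison of pairs of
    vertices into one of the third vertices of their edges. *)
Lemma third_color (p q r p' q' r' : 'I_3) : uniq [:: p; q; r] ->
  uniq [:: p'; q'; r'] -> perm_eq [:: p; q] [:: p'; q'] = (r == r').
Proof.
move=> u u'; have h := uniq3_perm u u'.
apply/idP/eqP => [pq|rr'].
  have : perm_eq ([:: p; q] ++ [:: r]) ([:: p; q] ++ [:: r']).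
    by apply: perm_trans h _; rewrite -[X in perm_eq X]/([:: p'; q'] ++ [:: r'])
      perm_cat2r perm_sym.
  by rewrite perm_cat2l => /perm_mem/(_ r); rewrite !inE eqxx => /esym/eqP.
by rewrite -(perm_cat2r [:: r]) {2}rr'.
Qed.

(** * Colorings supplied by robustness *)

Section Robust.
Hypothesis rob : robustly_strong_3colorable 2 H.

(** Distinct colors on [u] and [v] are valid whether or not the pair is a subhyperedge. *)
Lemma coloring_separate u v : u != v ->
  exists phi : coloring, sval phi u != sval phi v.
Proof.
move=> uv; pose f y : 'I_3 := if y == u then ord0 else ord_max.
have [||phi phiP e] := rob (U := [set u; v]) (phi' := f).
- by rewrite cards2 uv.
- move=> x y; rewrite !inE /f.
  case: (eqVneq x u) (eqVneq y u) => [->|_] [->|_] //=; rewrite ?eqxx //.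
  by move=> /eqP -> /eqP ->; rewrite eqxx.
exists (exist _ phi phiP); rewrite /= !e ?inE ?eqxx ?orbT // /f eqxx.
by rewrite (eq_sym v) (negPf uv).
Qed.

Lemma coloring_merge u v : ~~ subhyperedge [set u; v] ->
  exists phi : coloring, sval phi u = sval phi v.
Proof.
(* Robustness concerns two-element sets; for equal vertices any coloring serves. *)
case: (eqVneq u v) => [<- _|uv n].
  have [e eE] := set0Pn _ (hedge_nonempty H).
  have /card_gt1P[y [y' [_ _ yy']]] : 1 < #|e| by rewrite (hedge_uniform eE).
  by have [phi _] := coloring_separate yy'; exists phi.
have [||phi phiP e] := rob (U := [set u; v]) (phi' := fun=> ord0).
- by rewrite cards2 uv.
- move=> x y; rewrite !inE => /orP[] /eqP -> /orP[] /eqP ->; rewrite ?eqxx //.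
    by rewrite (negPf n).
  by rewrite setUC (negPf n).
by exists (exist _ phi phiP); rewrite /= !e ?inE ?eqxx ?orbT.
Qed.

(** Keeps the index set of the power nonempty, so that the tuple of the generator 0 has a coordinate
    [z]. *)
Lemma coloring_exists : exists phi : coloring, True.
Proof.
have [e eE] := set0Pn _ (hedge_nonempty H).
have /card_gt1P[y [y' [_ _ yy']]] : 1 < #|e| by rewrite (hedge_uniform eE).
by have [phi _] := coloring_separate yy'; exists phi.
Qed.

(** If [v, w, y] is an edge then every coloring gives [y] the color of [u], so
    [y = u]: robustness separates distinct vertices. *)
Lemma edge_of_colorings u v w :
  (forall phi : coloring, uniq [:: sval phi u; sval phi v; sval phi w]) ->
  [set u; v; w] \in E.
Proof.
move=> h; have [phi0 _] := coloring_exists.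
have vw : v != w.
  by apply/eqP => vw; have := h phi0; rewrite vw /= !inE eqxx andbF.
case: (boolP (subhyperedge [set v; w])) => [|/coloring_merge[phi e]]; last first.
  by have := h phi; rewrite e /= !inE eqxx andbF.
move/(subhyperedge2P vw) => [y e]; suff <- : y = u by rewrite -setUA setUC.
apply/eqP/negPn/negP => /coloring_separate[phi /negP]; apply.
have hr : uniq [:: sval phi v; sval phi w; sval phi u].
  by rewrite -(rot_uniq 2); apply: h.
by rewrite -(third_color (coloring_edge phi e) hr).
Qed.

(** * Evaluation of words in the power indexed by colorings *)

Variables (S : semigroupType) (z : S) (x : 'I_3 -> S).
Hypothesis xP : frame z x.

(** With [phi] as last argument, [word_eval s] is itself a tuple of the power. *)
Definition word_eval (s : hword) (phi : coloring) : S :=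
  wprod (fun o => if o is Some u then x (sval phi u) else z) s.

Lemma word_evalM s t phi :
  word_eval (s * t) phi = word_eval s phi * word_eval t phi.
Proof. exact: wprodM. Qed.

Definition has_zero (t : coloring -> S) : Prop := exists phi, t phi = z.

(** Equality in the Rees quotient of the power of [S] by the ideal of the
    tuples with a coordinate [z]. *)
Definition rees_eq (t t' : coloring -> S) : Prop :=
  t = t' \/ has_zero t /\ has_zero t'.

Lemma rees_eq_sym t t' : rees_eq t t' -> rees_eq t' t.
Proof. by case=> [->|[]]; [left|right]. Qed.

Lemma rees_eq_trans t t' t'' : rees_eq t t' -> rees_eq t' t'' -> rees_eq t t''.
Proof. by case=> [->//|[h h']] [<-|[_ h'']]; right. Qed.

Lemma rees_eq_has_zero t t' : rees_eq t t' -> has_zero t -> has_zero t'.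
Proof. by case=> [->|[]]. Qed.

Lemma has_zero_mull t t' : has_zero t -> has_zero (fun phi => t phi * t' phi).
Proof. by case=> phi e; exists phi; rewrite e (frame_zero xP).1. Qed.

Lemma has_zero_mulr t t' : has_zero t' -> has_zero (fun phi => t phi * t' phi).
Proof. by case=> phi e; exists phi; rewrite e (frame_zero xP).2. Qed.

Lemma rees_eqM t t' r r' : rees_eq t t' -> rees_eq r r' ->
  rees_eq (fun phi => t phi * r phi) (fun phi => t' phi * r' phi).
Proof.
case=> [->|[h h']]; last by right; split; apply: has_zero_mull.
by case=> [->|[h h']]; [left|right; split; apply: has_zero_mulr].
Qed.

Definition vword (v : free_semigroup V) : hword := (Some v.1, map Some v.2).

Definition color_word (phi : coloring) (v : free_semigroup V) :
  free_semigroup 'I_3 := (sval phi v.1, map (sval phi) v.2).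

Lemma word_eval_vword v phi :
  word_eval (vword v) phi = wprod x (color_word phi v).
Proof.
case: v => u s; rewrite /word_eval /wprod /=.
by elim/last_ind: s => [//|s y IH]; rewrite !map_rcons !foldl_rcons IH.
Qed.

(** Each defining relation holds in the Rees quotient, and [rees_eq] is a congruence. *)
Lemma word_eval_sound s t : cong (@hyp_rel H) s t ->
  rees_eq (word_eval s) (word_eval t).
Proof.
have [z0l z0r] := frame_zero xP; have [phi0 _] := coloring_exists.
have zero : has_zero (word_eval (gen0 H)) by exists phi0.
elim=> {s t} [s t|s|s t _|s t r _ st _|s s' t t' _ ss' _ tt'].
- case=> [u v|u|u||u v h|u v w h|i j r l h|u v w u' v' w' e e'].
  + by left; apply: funext => phi; apply: (frame_mulC xP).
  + by left; apply: funext => phi; apply: z0l.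
  + by left; apply: funext => phi; apply: z0r.
  + by left; apply: funext => phi; apply: z0l.
  + right; split=> //.
    have [phi e] : exists phi : coloring, sval phi u = sval phi v.
      by case: h => [->|/coloring_merge //]; exists phi0.
    by exists phi; rewrite /word_eval /wprod /= e (frame_sqr xP).
  (* If no coordinate vanished, every coloring would be injective on the triple, making it an
     edge. *)
  + right; split=> //; apply: contrapT => n; move/negP: h; apply.
    apply: edge_of_colorings => phi; apply/negPn/negP => nu; apply: n.
    exists phi; apply/(frame_wprod_eq0 xP (color_word phi (u, [:: v; w]))).
    exact: nu.
  (* The same vertex completes both pairs to edges, so in each coloring they use the same two
     colors. *)
  + case/and3P: h => _ _ /existsP[w /and3P[_ e e']]; rewrite setUC in e.
    rewrite setUC in e'; left; apply: funext => phi.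
    rewrite -[gen i * gen j]/(vword (i, [:: j])).
    rewrite -[gen r * gen l]/(vword (r, [:: l])).
    rewrite !word_eval_vword; apply: (perm_wprod _ (frame_mulC xP)).
    rewrite [perm_eq _ _](third_color (coloring_edge phi e)
      (coloring_edge phi e')).
    exact: eqxx.
  + left; apply: funext => phi.
    rewrite -[gen u * gen v * gen w]/(vword (u, [:: v; w])).
    rewrite -[gen u' * gen v' * gen w']/(vword (u', [:: v'; w'])).
    rewrite !word_eval_vword; apply: (perm_wprod _ (frame_mulC xP)).
    by apply: uniq3_perm => //; apply: coloring_edge.
- by left.
- exact: rees_eq_sym.
- exact: rees_eq_trans.
- rewrite (funext (word_evalM s t)) (funext (word_evalM s' t')).
  exact: rees_eqM.
Qed.

(** Edge words other than 0 have no coordinate [z], so equivalent ones have equal tuples. Their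
    color words are then permutations of each other, which fixes the length and leaves one
    comparison per length. *)
Lemma word_eval_edge_word s t : edge_word s -> edge_word t ->
  rees_eq (word_eval s) (word_eval t) -> pi s = pi t.
Proof.
have [phi0 _] := coloring_exists.
pose colored v := forall phi, uniq (word_seq (color_word phi v)).
have nz v : colored v -> ~ has_zero (word_eval (vword v)).
  by move=> vc [phi]; rewrite word_eval_vword => /(frame_wprod_eq0 xP)/negP.
have zero : has_zero (word_eval (gen0 H)) by exists phi0.
have n0 v : colored v -> ~ rees_eq (word_eval (gen0 H)) (word_eval (vword v)).
  by move=> /nz n /rees_eq_has_zero/(_ zero).
have permE v v' : colored v ->
    rees_eq (word_eval (vword v)) (word_eval (vword v')) -> forall phi,
    perm_eq (word_seq (color_word phi v)) (word_seq (color_word phi v')).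
  move=> vc [e|[/(nz _ vc) //]] phi; apply: (frame_wprod_inj xP) => //.
  by rewrite -!word_eval_vword e.
have c1 u : colored (u, [::]) by [].
have c3 u v w : [set u; v; w] \in E -> colored (u, [:: v; w]).
  by move=> e phi; apply: coloring_edge.
have c2 u v w : [set u; v; w] \in E -> colored (u, [:: v]).
  move=> /c3 h phi; have := h phi; rewrite /word_seq /= !inE negb_or.
  by case/andP => /andP[-> _].
have size_eq v v' : colored v ->
    rees_eq (word_eval (vword v)) (word_eval (vword v')) ->
    size v.2 = size v'.2.
  by move=> vc /(permE _ _ vc)/(_ phi0)/perm_size; rewrite /= !size_map => -[].
case=> [|u|u v w e|u v w e]; case=> [|u'|u' v' w' e'|u' v' w' e'] //.
- by case/(n0 (u', [::]) (c1 _)).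
- by case/(n0 (u', [:: v']) (c2 _ _ _ e')).
- by case/(n0 (u', [:: v'; w']) (c3 _ _ _ e')).
- by move/rees_eq_sym => /(n0 (u, [::]) (c1 _)).
- move/(permE (u, [::]) (u', [::]) (c1 _)) => h; congr (pi (gen _)).
  apply/eqP/negPn/negP => /coloring_separate[phi /negP]; apply.
  by have /perm_mem/(_ (sval phi u)) := h phi; rewrite !inE eqxx => /esym.
- by move/(size_eq (u, [::]) (u', [:: v']) (c1 _)).
- by move/(size_eq (u, [::]) (u', [:: v'; w']) (c1 _)).
- by move/rees_eq_sym => /(n0 (u, [:: v]) (c2 _ _ _ e)).
- by move/(size_eq (u, [:: v]) (u', [::]) (c2 _ _ _ e)).
(* The third vertices of the two edges have the same color in every coloring, hence coincide, and
   the pairs are linked. *)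
- move/(permE (u, [:: v]) (u', [:: v']) (c2 _ _ _ e)) => h.
  apply/hyp_relE/hyp_linked; suff ww' : w = w'.
    by rewrite -ww' in e'; apply: linkedP e e'.
  apply/eqP/negPn/negP => /coloring_separate[phi /negP]; apply.
  rewrite -(third_color (coloring_edge phi e) (coloring_edge phi e')).
  exact: h.
- by move/(size_eq (u, [:: v]) (u', [:: v'; w']) (c2 _ _ _ e)).
- by move/rees_eq_sym => /(n0 (u, [:: v; w]) (c3 _ _ _ e)).
- by move/(size_eq (u, [:: v; w]) (u', [::]) (c3 _ _ _ e)).
- by move/(size_eq (u, [:: v; w]) (u', [:: v']) (c3 _ _ _ e)).
- by move=> _; apply/hyp_relE/hyp_edge.
Qed.

Lemma word_evalP s t : rees_eq (word_eval s) (word_eval t) <-> pi s = pi t.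
Proof.
split=> [|/quot_eqP]; last exact: word_eval_sound.
have [s' s'w ss'] := edge_word_repr s; have [t' t'w tt'] := edge_word_repr t.
move=> st; rewrite ss' tt'; apply: word_eval_edge_word => //.
have /rees_eq_sym := word_eval_sound (proj1 (quot_eqP _ _ _) ss').
move=> /rees_eq_trans; apply; apply: rees_eq_trans st _.
exact: word_eval_sound (proj1 (quot_eqP _ _ _) tt').
Qed.

(** Besides the values of words, the domain of [R] contains every tuple with a coordinate [z],
    related to 0; this closes it under addition. *)
Lemma hyp_in_variety (z0 : is_zero z) (zc : zero_cancellative z) :
  variety_gen (flat_semiring z0 zc) (hyp_semiring H).
Proof.
have [phi0 _] := coloring_exists.
pose R (t : coloring -> flat_semiring z0 zc) (s : hyp_semiring H) :=
  exists2 w, rees_eq t (word_eval w) & s = pi w.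
have zero : has_zero (word_eval (gen0 H)) by exists phi0.
apply: (variety_gen_rel (R := R)).
- move=> t s s' [w tw ->] [w' tw' ->]; apply/word_evalP.
  exact: rees_eq_trans (rees_eq_sym tw) tw'.
- by move=> s; exists (word_eval (repr s)), (repr s); [left|rewrite reprK].
- move=> t t' s s' [w tw ->] [w' tw' ->]; rewrite /R flat_semiring_add.
  case: (EM (t = t')) => [tt'|tt'].
    have ww' : pi w = pi w'.
      by apply/word_evalP/(rees_eq_trans (rees_eq_sym tw)); rewrite tt'.
    exists w; last by rewrite ww' eqxx.
    rewrite tt' in tw *; rewrite (_ : (fun _ => _) = t') //.
    by apply: funext => phi; rewrite flat_semiring_add eqxx.
  (* Distinct tuples differ at some coloring, where their flat sum is [z]. *)
  have h : has_zero (fun phi => sr_add (t phi) (t' phi)).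
    apply: contrapT => n; apply: tt'; apply: funext => phi.
    apply: contrapT => /eqP/negPf e; apply: n.
    by exists phi; rewrite flat_semiring_add e.
  exists (gen0 H); first by right.
  (* If distinct tuples have the same class, both have a coordinate [z], so that class is 0 and the
     sum is still 0. *)
  case: eqP => [/word_evalP ww'|//]; apply/word_evalP; right; split=> //.
  case: (rees_eq_trans tw (rees_eq_trans ww' (rees_eq_sym tw'))) => [//|[ht _]].
  exact: rees_eq_has_zero tw ht.
- move=> t t' s s' [w tw ->] [w' tw' ->]; exists (w * w').
    by rewrite (funext (word_evalM w w')); apply: rees_eqM.
  by rewrite hyp_piM.
Qed.

End Robust.

End Hypergraph.

(** * The two inclusions between the varieties *)

Theorem theorem3p4 (H : hypergraph3) (K : choiceType) (a b c : K) :
  uniq [:: a; b; c] ->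
  robustly_strong_3colorable 2 H ->
  variety_gen (hyp_semiring H) =
  variety_gen (Sc_semiring [mset a; b; c]%mset).
Proof.
move=> abc rob; apply: eq_variety_gen; last first.
  exact: (hyp_in_variety rob (Sc_frame abc)).
have [e eE] := set0Pn _ (hedge_nonempty H).
have /card_gt1P[u [v [ue ve uv]]] : 1 < #|e| by rewrite (hedge_uniform eE).
have [w ew] := edge_split2 eE ue ve uv; rewrite ew in eE.
apply: frame_variety_gen (hyp_frame eE) (Sc_frame abc) _.
exact: Sc_wprod_surj.
Qed.
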